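(* Let $n\ge 2$ and let $\phi:R\to S$ be an $n$-homomorphism between unital rings. Then $\phi$ induces a group homomorphism $$\phi_*:K_0^n(R)\longrightarrow K_0^n(S).$$ Furthermore, the assignment $R\mapsto K_0^n(R)$ is a covariant functor from the category of unital rings and $n$-homomorphisms to the category of abelian groups and ordinary group homomorphisms.
   Context: Let $R,S$ be rings. An additive map $\phi:R\to S$ (not necessarily unital) is an $n$-homomorphism if $\phi(a_1a_2\cdots a_n)=\phi(a_1)\phi(a_2)\cdots\phi(a_n)$ for all $a_1,\dots,a_n\in R$. An $n$-potent in a ring $R$ is an element $e$ with $e^n=e$. For a unital ring $R$, let $M_\infty(R)=\bigcup_k M_k(R)$, the direct limit under $a\mapsto \mathrm{diag}(a,0)$, and let $\mathcal{P}^n_\infty(R)$ be the set of $n$-potents in $M_\infty(R)$. For $e,f\in\mathcal{P}^n_\infty(R)$ write $e\sim f$ if, for $k$ large enough that $e,f\in M_k(R)$, there are $a,b\in M_k(R)$ with $e=ab$ and $f=ba$. Let $\mathcal{V}^n(R)$ be the set of equivalence classes, an abelian monoid under $[e]+[f]=[\mathrm{diag}(e,f)]$ with identity $[0]$. The group $K_0^n(R)$ is the Grothendieck completion of $\mathcal{V}^n(R)$. The induced map $\phi_*$ is the one obtained by applying $\phi$ to each matrix entry: $\phi_*[(a_{ij})]=[(\phi(a_{ij}))]$ for an $n$-potent matrix $(a_{ij})$ over $R$. *)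

(* Defs.v *)
From HB Require Import structures.
From mathcomp Require Import all_boot all_algebra.
From mathcomp Require Import boolp.

Set Implicit Arguments.
Unset Strict Implicit.
Unset Printing Implicit Defensive.

Import GRing.Theory.
Local Open Scope ring_scope.
Local Open Scope quotient_scope.

Record category := Category {
  cat_ob :> Type;
  cat_hom : cat_ob -> cat_ob -> Type;
  cat_id : forall A, cat_hom A A;
  cat_comp : forall A B C, cat_hom B C -> cat_hom A B -> cat_hom A C;
  cat_comp1f : forall A B (f : cat_hom A B), cat_comp (cat_id B) f = f;
  cat_compf1 : forall A B (f : cat_hom A B), cat_comp f (cat_id A) = f;
  cat_compA : forall A B C D (h : cat_hom C D) (g : cat_hom B C)
    (f : cat_hom A B), cat_comp h (cat_comp g f) = cat_comp (cat_comp h g) f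
}.
Arguments cat_hom {c} A B.
Arguments cat_id {c} A.
Arguments cat_comp {c A B C} g f.

Definition is_covariant_functor (C D : category) (Fob : C -> D)
    (Fhom : forall A B : C, cat_hom A B -> cat_hom (Fob A) (Fob B)) : Prop :=
  (forall A : C, Fhom A A (cat_id A) = cat_id (Fob A)) /\
  (forall (A B E : C) (g : cat_hom B E) (f : cat_hom A B),
     Fhom A E (cat_comp g f) = cat_comp (Fhom B E g) (Fhom A B f)).

Lemma additive_ext (U V : nmodType) (f g : {additive U -> V}) :
  f =1 g -> f = g.
Proof.
case: f g => [f [[cf]]] [g [[cg]]] /= /funext fg.
by subst g; rewrite (Prop_irrelevance cf cg).
Qed.

Definition additive_id (U : nmodType) : {additive U -> U} := idfun.
Definition additive_comp (U V W : nmodType) (g : {additive V -> W})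
  (f : {additive U -> V}) : {additive U -> W} := g \o f.

Definition ab_category : category.
Proof.
refine (@Category zmodType (fun U V => {additive U -> V})
  (fun U => additive_id U) (fun U V W g f => additive_comp g f) _ _ _).
- by move=> U V f; apply: additive_ext.
- by move=> U V f; apply: additive_ext.
- by move=> U V W X h g f; apply: additive_ext.
Defined.

(* Unital rings are pzRingTypes, so the zero ring is allowed. The products  *)
(* are taken in the order of the indices, and phi 1 = 1 is not required.    *)
Record nhom (n : nat) (R S : pzRingType) := NHom {
  nhom_add :> {additive R -> S};
  nhom_prod : forall a : 'I_n -> R,
    nhom_add (\prod_(i < n) a i) = \prod_(i < n) nhom_add (a i)
}.

Lemma nhom_ext n (R S : pzRingType) (f g : nhom n R S) : f =1 g -> f = g.
Proof.
case: f g => [f pf] [g pg] /= /additive_ext fg.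
by subst g; rewrite (Prop_irrelevance pf pg).
Qed.

Definition nhom_id n (R : pzRingType) : nhom n R R :=
  @NHom n R R (additive_id R) (fun _ => erefl).

Lemma nhom_comp_prod n (R S T : pzRingType) (g : nhom n S T) (f : nhom n R S)
    (a : 'I_n -> R) :
  additive_comp g f (\prod_(i < n) a i) =
  \prod_(i < n) additive_comp g f (a i).
Proof. by rewrite /= nhom_prod nhom_prod. Qed.

Definition nhom_comp n (R S T : pzRingType) (g : nhom n S T) (f : nhom n R S) :
  nhom n R T := NHom (nhom_comp_prod g f).

Definition nring_category (n : nat) : category.
Proof.
refine (@Category pzRingType (nhom n) (nhom_id n) (@nhom_comp n) _ _ _).
- by move=> R S f; apply: nhom_ext.
- by move=> R S f; apply: nhom_ext.
- by move=> R S T U h g f; apply: nhom_ext.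
Defined.

Section Grothendieck.
Variable M : nmodType.
Implicit Types x y z : M * M.

(* The pair (a, b) stands for a - b; M need not be cancellative. *)
Definition groth_rel x y : bool :=
  `[< exists k : M, x.1 + y.2 + k = y.1 + x.2 + k >].

Lemma groth_rel_refl : reflexive groth_rel.
Proof. by move=> x; apply/asboolP; exists 0. Qed.

Lemma groth_rel_sym : symmetric groth_rel.
Proof.
by move=> x y; apply/asboolP/asboolP => -[k Hk]; exists k; rewrite Hk.
Qed.

Lemma groth_rel_trans : transitive groth_rel.
Proof.
move=> y x z /asboolP[k xy] /asboolP[l yz]; apply/asboolP.
exists (y.2 + k + (y.1 + l)).
rewrite (AC (2*(2*2)) ((1*3*4)*(5*2*6)))/= xy yz.
by rewrite (AC (3*3) ((4*2)*((5*3)*(1*6)))).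
Qed.

Canonical groth_equiv :=
  EquivRel groth_rel groth_rel_refl groth_rel_sym groth_rel_trans.

Definition groth := {eq_quot groth_rel}.
HB.instance Definition _ : EqQuotient _ groth_rel groth := EqQuotient.on groth.
HB.instance Definition _ := Choice.on groth.

Definition groth_add (a b : groth) : groth :=
  \pi_groth ((repr a).1 + (repr b).1, (repr a).2 + (repr b).2).
Definition groth_opp (a : groth) : groth := \pi_groth ((repr a).2, (repr a).1).
Definition groth_zero : groth := \pi_groth (0, 0).

Lemma groth_piP x y :
  (exists k : M, x.1 + y.2 + k = y.1 + x.2 + k) <->
  \pi_groth x = \pi_groth y.
Proof.
split=> [Hk|/eqmodP/asboolP//]; first by apply/eqmodP/asboolP.
Qed.

Lemma groth_addE x y :
  groth_add (\pi x) (\pi y) = \pi_groth (x.1 + y.1, x.2 + y.2).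
Proof.
apply/groth_piP => /=.
have [k Hk] := (groth_piP _ x).2 (reprK (\pi_groth x)).
have [l Hl] := (groth_piP _ y).2 (reprK (\pi_groth y)).
exists (k + l); move: Hk Hl.
set a := repr _; set b := repr _ => Hk Hl.
rewrite (AC ((2*2)*2) ((1*3*5)*(2*4*6)))/= Hk Hl.
by rewrite (AC (3*3) ((1*4)*(2*5)*(3*6))).
Qed.

Lemma groth_oppE x : groth_opp (\pi x) = \pi_groth (x.2, x.1).
Proof.
apply/groth_piP => /=.
have [k Hk] := (groth_piP _ x).2 (reprK (\pi_groth x)).
by exists k; rewrite [_ + x.1]addrC -Hk [_ + x.2]addrC.
Qed.

Lemma groth_addA : associative groth_add.
Proof.
elim/quotW=> x; elim/quotW=> y; elim/quotW=> z.
by rewrite !groth_addE /= !addrA.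
Qed.

Lemma groth_addC : commutative groth_add.
Proof.
elim/quotW=> x; elim/quotW=> y; rewrite !groth_addE.
by rewrite [x.1 + _]addrC [x.2 + _]addrC.
Qed.

Lemma groth_add0 : left_id groth_zero groth_add.
Proof. by elim/quotW=> -[x1 x2]; rewrite groth_addE /= !add0r. Qed.

Lemma groth_addN : left_inverse groth_zero groth_opp groth_add.
Proof.
elim/quotW=> x; rewrite groth_oppE groth_addE; apply/groth_piP.
by exists 0; rewrite /= !addr0 add0r addrC.
Qed.

HB.instance Definition _ :=
  GRing.isZmodule.Build groth groth_addA groth_addC groth_add0 groth_addN.

Definition groth_in (a : M) : groth := \pi_groth (a, 0).

Lemma groth_in_is_additive : nmod_morphism groth_in.
Proof.
split=> // a b; rewrite [RHS]groth_addE /=.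
by rewrite addr0.
Qed.

HB.instance Definition _ :=
  GRing.isNmodMorphism.Build M groth groth_in groth_in_is_additive.

End Grothendieck.

(* For k <= m this is diag(e, 0), i.e., the image of e under the structural *)
(* embedding of M_k(R) into M_m(R); it is a truncation for m < k.           *)
Definition corner (R : pzRingType) (k m : nat) (e : 'M[R]_k) : 'M[R]_m :=
  pid_mx k *m e *m pid_mx k.

(* An n-potent of M_oo(R) is given by one of its finite representatives,    *)
(* i.e., an n-potent matrix of some size k. Distinct representatives of the *)
(* same element of M_oo(R) are identified by npotent_rel (corner_eqv).      *)
Inductive npotent (n : nat) (R : pzRingType) :=
  NPotent (x : {k : nat & 'M[R]_k}) of tagged x ^+ n == tagged x.

Section NPotent.
Variables (n : nat) (R : pzRingType).

Definition npotent_val (e : npotent n R) := let: NPotent x _ := e in x.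
HB.instance Definition _ := [isSub of npotent n R for npotent_val].
HB.instance Definition _ := [Choice of npotent n R by <:].

Definition npotent_size (e : npotent n R) : nat := tag (val e).
Definition npotent_mx (e : npotent n R) : 'M[R]_(npotent_size e) :=
  tagged (val e).

Definition npotent_of k (e : 'M[R]_k) (he : e ^+ n = e) : npotent n R :=
  @NPotent n R (existT (fun k => 'M[R]_k) k e) (introT eqP he).

Lemma npotent_mxP (e : npotent n R) : npotent_mx e ^+ n = npotent_mx e.
Proof. exact/eqP/(valP e). Qed.

Definition npotent_rel (e f : npotent n R) : bool :=
  `[< exists m : nat,
        [/\ (npotent_size e <= m)%N, (npotent_size f <= m)%N
          & exists a b : 'M[R]_m,
              corner m (npotent_mx e) = a *m b /\
              corner m (npotent_mx f) = b *m a] >].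

Hypothesis n_gt1 : (1 < n)%N.

Let corner_in k m : (k <= m)%N ->
  (pid_mx k : 'M[R]_(k, m)) *m (pid_mx k : 'M[R]_(m, k)) = 1%:M.
Proof. by move=> km; rewrite pid_mx_id // pid_mx_1. Qed.

Let mxS k (e : 'M[R]_k) p : e ^+ p.+1 = e *m e ^+ p.
Proof. exact: exprS. Qed.

Let mxSr k (e : 'M[R]_k) p : e ^+ p.+1 = e ^+ p *m e.
Proof. exact: exprSr. Qed.

Let exprS1 k (e : 'M[R]_k) : e ^+ n = e -> e *m e ^+ n.-1 = e.
Proof. by rewrite -mxS (ltn_predK n_gt1). Qed.

Let expr1S k (e : 'M[R]_k) : e ^+ n = e -> e ^+ n.-1 *m e = e.
Proof. by rewrite -mxSr (ltn_predK n_gt1). Qed.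

Let exprBA k l (a : 'M[R]_(k, l)) (b : 'M[R]_(l, k)) p :
  (a *m b) ^+ p *m a = a *m (b *m a) ^+ p.
Proof.
elim: p => [|p IH]; first by rewrite !expr0 mul1mx mulmx1.
by rewrite mxS [in RHS]mxS -mulmxA IH !mulmxA.
Qed.

Lemma corner_npotent k m (e : 'M[R]_k) :
  (k <= m)%N -> e ^+ n = e -> corner m e ^+ n = corner m e.
Proof.
move=> km he; suff H p : corner m e ^+ p.+1 = corner m (e ^+ p.+1).
  by rewrite -[in LHS](ltn_predK n_gt1) H (ltn_predK n_gt1) he.
elim: p => [|p IH]; first by rewrite !expr1.
rewrite mxS IH [e ^+ p.+2]mxS.
rewrite /corner !mulmxA.
by rewrite -(mulmxA (_ *m e)) corner_in // mulmx1.
Qed.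

(* In particular the size m in the definition of npotent_rel is immaterial. *)
Lemma npotent_relP (e f : npotent n R) :
  reflect (exists (a : 'M[R]_(npotent_size e, npotent_size f))
                  (b : 'M[R]_(npotent_size f, npotent_size e)),
              npotent_mx e = a *m b /\ npotent_mx f = b *m a)
          (npotent_rel e f).
Proof.
have := npotent_mxP f; have := npotent_mxP e; rewrite /npotent_rel.
move: (npotent_mx e) (npotent_mx f).
move: (npotent_size e) (npotent_size f) => k l E F hE hF.
apply: (iffP (asboolP _)); last first.
  case=> a [b [Eab Fba]]; exists (maxn k l).
  split; [exact: leq_maxl|exact: leq_maxr|].
  exists (pid_mx k *m a *m pid_mx l), (pid_mx l *m b *m pid_mx k).
  rewrite /corner Eab Fba; split; rewrite !mulmxA.
    by rewrite -(mulmxA (_ *m a) (pid_mx l)) corner_in ?leq_maxr// mulmx1.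
  by rewrite -(mulmxA (_ *m b) (pid_mx k)) corner_in ?leq_maxl// mulmx1.
case=> m [km lm [a [b [Eab Fba]]]].
have hab := corner_npotent km hE; have hba := corner_npotent lm hF.
have cornerK j (A : 'M[R]_j) : (j <= m)%N ->
    pid_mx j *m corner m A *m pid_mx j = A.
  move=> jm; rewrite /corner !mulmxA corner_in // mul1mx.
  by rewrite -mulmxA corner_in // mulmx1.
have cornerJ j (A : 'M[R]_j) : (j <= m)%N ->
    corner m A *m ((pid_mx j : 'M_(m, j)) *m (pid_mx j : 'M_(j, m))) =
    corner m A.
  by move=> jm; rewrite /corner !mulmxA -(mulmxA (_ *m A)) corner_in // mulmx1.
have absorb j (A : 'M[R]_j) p : (j <= m)%N -> (0 < p)%N ->
    corner m A ^+ p *m ((pid_mx j : 'M_(m, j)) *m (pid_mx j : 'M_(j, m))) =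
    corner m A ^+ p.
  move=> jm; case: p => // p _.
  by rewrite mxSr -mulmxA cornerJ.
have n1 : (0 < n.-1)%N by case: n n_gt1 => [|[]].
pose I j : 'M[R]_(j, m) := pid_mx j; pose J j : 'M[R]_(m, j) := pid_mx j.
exists (I k *m (a *m corner m F ^+ n.-1) *m J l),
       (I l *m (b *m corner m E ^+ n.-1) *m J k); split.
  transitivity (I k *m (a *m (corner m F ^+ n.-1 *m (J l *m I l)) *m b *m
    corner m E ^+ n.-1) *m J k); last by rewrite !mulmxA.
  rewrite absorb // Fba -exprBA -Eab -(mulmxA _ a b) -Eab.
  by rewrite expr1S // exprS1 // cornerK.
transitivity (I l *m (b *m (corner m E ^+ n.-1 *m (J k *m I k)) *m a *m
  corner m F ^+ n.-1) *m J l); last by rewrite !mulmxA.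
rewrite absorb // Eab -exprBA -Fba -(mulmxA _ b a) -Fba.
by rewrite expr1S // exprS1 // cornerK.
Qed.

Lemma npotent_rel_refl : reflexive npotent_rel.
Proof.
move=> e; apply/npotent_relP; exists (npotent_mx e), (npotent_mx e ^+ n.-1).
by rewrite exprS1 ?expr1S //; apply: npotent_mxP.
Qed.

Lemma npotent_rel_sym : symmetric npotent_rel.
Proof.
by move=> e f; apply/npotent_relP/npotent_relP => -[a [b [? ?]]]; exists b, a.
Qed.

Lemma npotent_rel_trans : transitive npotent_rel.
Proof.
move=> f e g /npotent_relP[a [b [Eab Fba]]] /npotent_relP[c [d [Fcd Gdc]]].
apply/npotent_relP.
move: (npotent_mxP e) (npotent_mxP g); rewrite Eab Gdc => hE hG.
exists (a *m npotent_mx f ^+ n.-2 *m c), (d *m b).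
have n2 : n = n.-2.+2 by case: n n_gt1 => [|[]].
have lem k l (a' : 'M[R]_(k, l)) (b' : 'M[R]_(l, k)) :
    (a' *m b') ^+ n = a' *m b' -> a' *m (b' *m a') ^+ n.-1 *m b' = a' *m b'.
  by move=> h; rewrite -exprBA -mulmxA -mxSr (ltn_predK n_gt1).
have n1 : n.-1 = n.-2.+1 by rewrite {1}n2.
split.
  rewrite -{1}(lem _ _ _ _ hE) -Fba n1 mxSr {2}Fcd.
  by rewrite !mulmxA.
rewrite -{1}(lem _ _ _ _ hG) -Fcd n1 mxS {1}Fba.
by rewrite !mulmxA.
Qed.

Lemma corner_eqv k m (e : 'M[R]_k) (he : e ^+ n = e) (km : (k <= m)%N) :
  npotent_rel (npotent_of he) (npotent_of (corner_npotent km he)).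
Proof.
apply/npotent_relP; exists (e *m pid_mx k), (pid_mx k *m e ^+ n.-1).
rewrite /npotent_mx /=; split.
  by rewrite mulmxA -(mulmxA e) corner_in // mulmx1 exprS1.
by rewrite mulmxA -(mulmxA _ _ e) expr1S.
Qed.

Definition npotent_equiv :=
  EquivRel npotent_rel npotent_rel_refl npotent_rel_sym npotent_rel_trans.

Lemma npotent_add_subproof (e f : npotent n R) :
  block_mx (npotent_mx e) 0 0 (npotent_mx f) ^+ n =
  block_mx (npotent_mx e) 0 0 (npotent_mx f).
Proof.
suff H k l (A : 'M[R]_k) (B : 'M[R]_l) p :
    block_mx A 0 0 B ^+ p.+1 = block_mx (A ^+ p.+1) 0 0 (B ^+ p.+1).
  by rewrite -[in LHS](ltn_predK n_gt1) H (ltn_predK n_gt1) !npotent_mxP.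
elim: p => [|p IH]; first by rewrite !expr1.
rewrite mxS IH mulmx_block.
by rewrite !mulmx0 !mul0mx !addr0 add0r [A ^+ p.+2]mxS [B ^+ p.+2]mxS.
Qed.

Definition npotent_add (e f : npotent n R) : npotent n R :=
  npotent_of (npotent_add_subproof e f).

Lemma npotent_zero_subproof : (0 : 'M[R]_0) ^+ n = 0.
Proof. by rewrite expr0n; case: n n_gt1. Qed.

Definition npotent_zero : npotent n R := npotent_of npotent_zero_subproof.

Lemma npotent_add_compat (e e' f f' : npotent n R) :
  npotent_rel e e' -> npotent_rel f f' ->
  npotent_rel (npotent_add e f) (npotent_add e' f').
Proof.
move=> /npotent_relP[a [b [Eab Eba]]] /npotent_relP[c [d [Fcd Fdc]]].
apply/npotent_relP; exists (block_mx a 0 0 c), (block_mx b 0 0 d).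
rewrite /npotent_mx /= -!/(npotent_mx _) Eab Eba Fcd Fdc !mulmx_block.
by rewrite !mulmx0 !mul0mx !addr0 !add0r.
Qed.

Lemma npotent_addC (e f : npotent n R) :
  npotent_rel (npotent_add e f) (npotent_add f e).
Proof.
apply/npotent_relP.
exists (block_mx 0 (npotent_mx e) (npotent_mx f) 0).
exists (block_mx 0 (npotent_mx f ^+ n.-1) (npotent_mx e ^+ n.-1) 0).
rewrite {1 4}/npotent_mx /= -!/(npotent_mx _) !mulmx_block.
rewrite !mulmx0 !mul0mx !addr0 !add0r.
by rewrite !exprS1 ?expr1S //; apply: npotent_mxP.
Qed.

Lemma npotent_rel_cast k l (A : 'M[R]_k) (B : 'M[R]_l) (hA : A ^+ n = A)
    (hB : B ^+ n = B) (kl : k = l) :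
  castmx (kl, kl) A = B -> npotent_rel (npotent_of hA) (npotent_of hB).
Proof.
case: _ / kl B hB => B hB; rewrite castmx_id => AB; case: _ / AB hB => hB.
by rewrite (Prop_irrelevance hA hB) npotent_rel_refl.
Qed.

Lemma npotent_addA (e f g : npotent n R) :
  npotent_rel (npotent_add e (npotent_add f g))
              (npotent_add (npotent_add e f) g).
Proof.
rewrite npotent_rel_sym; apply: npotent_rel_cast.
  by rewrite /npotent_size /= addnA.
move=> kl.
have := @block_mxA R _ _ _ _ _ _ (npotent_mx e) 0 0 0 (npotent_mx f) 0 0 0
  (npotent_mx g).
rewrite /= !row_mx0 !col_mx0 => H.
by rewrite {2}/npotent_mx /= H; congr castmx; congr pair; apply: eq_irrelevance.
Qed.

Lemma npotent_add0 (e : npotent n R) :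
  npotent_rel (npotent_add npotent_zero e) e.
Proof.
apply/npotent_relP.
exists (col_mx 0 (npotent_mx e)), (row_mx 0 (npotent_mx e ^+ n.-1)).
rewrite {1}/npotent_mx /= mul_col_row mul_row_col !mul0mx !mulmx0 add0r.
by rewrite exprS1 ?expr1S //; apply: npotent_mxP.
Qed.

End NPotent.

Section Vn.
Variables (n : nat) (n_gt1 : (1 < n)%N) (R : pzRingType).

Definition Vn := {eq_quot npotent_equiv R n_gt1}.
HB.instance Definition _ : EqQuotient _ (npotent_equiv R n_gt1) Vn :=
  EqQuotient.on Vn.
HB.instance Definition _ := Choice.on Vn.

Definition Vn_add (x y : Vn) : Vn :=
  \pi_Vn (npotent_add n_gt1 (repr x) (repr y)).
Definition Vn_zero : Vn := \pi_Vn (npotent_zero R n_gt1).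

Lemma Vn_piP (e f : npotent n R) :
  npotent_rel e f <-> \pi_Vn e = \pi_Vn f.
Proof. by split=> [ef|/eqmodP//]; apply/eqmodP. Qed.

Lemma Vn_addE (e f : npotent n R) :
  Vn_add (\pi e) (\pi f) = \pi_Vn (npotent_add n_gt1 e f).
Proof.
by apply/Vn_piP/npotent_add_compat; apply/Vn_piP; rewrite reprK.
Qed.

Lemma Vn_addA : associative Vn_add.
Proof.
elim/quotW=> e; elim/quotW=> f; elim/quotW=> g.
by rewrite !Vn_addE; apply/Vn_piP/npotent_addA.
Qed.

Lemma Vn_addC : commutative Vn_add.
Proof.
elim/quotW=> e; elim/quotW=> f.
by rewrite !Vn_addE; apply/Vn_piP/npotent_addC.
Qed.

Lemma Vn_add0 : left_id Vn_zero Vn_add.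
Proof. by elim/quotW=> e; rewrite Vn_addE; apply/Vn_piP/npotent_add0. Qed.

HB.instance Definition _ :=
  GRing.isNmodule.Build Vn Vn_addA Vn_addC Vn_add0.

End Vn.

Definition K0n (n : nat) (n_gt1 : (1 < n)%N) (R : pzRingType) : zmodType :=
  groth (Vn n_gt1 R).

Definition K0n_class (n : nat) (n_gt1 : (1 < n)%N) (R : pzRingType) (k : nat)
    (e : 'M[R]_k) (he : e ^+ n = e) : K0n n_gt1 R :=
  groth_in (\pi_(Vn n_gt1 R) (npotent_of he)).

(* Main.v *)
Require Import Defs.
From HB Require Import structures.
From mathcomp Require Import all_boot all_algebra.
From mathcomp Require Import boolp.

(** An [n]-homomorphism [phi] need not preserve products of two elements, but
    everything that enters [K_0^n] can be written with [n]-fold products.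

    An entry of a product of [n] matrices of compatible, possibly rectangular,
    shapes is a sum of [n]-fold products of entries; hence the entrywise
    extension of [phi] preserves [n]-fold matrix products ([map_fold_mx_n]). In
    particular it sends [n]-potents to [n]-potents.

    The point that needs an idea is the relation [e = a b], [f = b a], since
    [phi(a b)] and [phi(a) phi(b)] differ in general. As [e] and [f] are
    [n]-potent, [e] and [f] can be padded to [n]-fold products:
    [e = (a b)^n = a f^(n-2) (f b)] and [f = f^n = f^(n-2) (f b) a].
    These have the same [n] factors up to a cyclic rotation, so [A = phi(a)]
    and [B = phi(f)^(n-2) phi(f b)] satisfy [phi(e) = A B] and [phi(f) = B A]
    ([map_mx_swap]).

    Block sums are preserved entrywise, which gives a monoid morphism on
    [V^n]; the Grothendieck completion is functorial for monoid morphisms, and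
    identities and composites are preserved because they are so on entries. *)

Set Implicit Arguments.
Unset Strict Implicit.
Unset Printing Implicit Defensive.

Import GRing.Theory.
Local Open Scope ring_scope.
Local Open Scope quotient_scope.

(** * Matrix products under an n-homomorphism *)

Section NhomMatrix.
Variables (n : nat) (R S : pzRingType) (phi : nhom n R S).

Lemma nhom_prod_seq (s : seq R) : size s = n ->
  phi (\prod_(x <- s) x) = \prod_(x <- s) phi x.
Proof.
move=> sn; rewrite !(big_nth (0 : R)) sn !big_mkord.
exact: (nhom_prod phi (fun i => nth 0 s i)).
Qed.

(** The pair [(Y, Y')] behaves like a product of [p] matrices over [R] together
    with the product of their images: [phi] can be distributed over [Y] once
    the missing [n - p] scalar factors are supplied on the left. This makes
    sense without [phi] being multiplicative on [p]-fold products, and is what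
    an induction on the number of factors needs. *)
Definition fold_mx p k l (Y : 'M[R]_(k, l)) (Y' : 'M[S]_(k, l)) :=
  forall s : seq R, (size s + p)%N = n -> forall i j,
    phi ((\prod_(x <- s) x) * Y i j) = (\prod_(x <- s) phi x) * Y' i j.

Lemma fold_mx1 k l (Y : 'M[R]_(k, l)) : fold_mx 1 Y (map_mx phi Y).
Proof.
move=> s sn i j; rewrite mxE.
have := @nhom_prod_seq (rcons s (Y i j)).
by rewrite size_rcons -addn1 !big_rcons /= => ->.
Qed.

(** Each entry of the new factor joins the list of scalars on the left. *)
Lemma fold_mxS p k l m (X : 'M[R]_(k, l)) (Y : 'M[R]_(l, m)) Y' :
  fold_mx p Y Y' -> fold_mx p.+1 (X *m Y) (map_mx phi X *m Y').
Proof.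
move=> hY s sn i j; rewrite !mxE !mulr_sumr raddf_sum.
apply: eq_bigr => u _; rewrite !mulrA mxE.
have := hY (rcons s (X i u)); rewrite size_rcons addSnnS => /(_ sn u j).
by rewrite !big_rcons.
Qed.

Lemma fold_mxX p k l q (F : 'M[R]_k) (Y : 'M[R]_(k, l)) Y' :
  fold_mx p Y Y' -> fold_mx (q + p) (F ^+ q *m Y) (map_mx phi F ^+ q *m Y').
Proof.
move=> hY; elim: q => [|q IH]; first by rewrite !expr0 !mul1mx.
by rewrite addSn !exprS -!mulmxA; apply: fold_mxS.
Qed.

Lemma fold_mx_expr q k (F : 'M[R]_k) :
  fold_mx q.+1 (F ^+ q.+1) (map_mx phi F ^+ q.+1).
Proof.
by rewrite !exprSr -addn1; apply: fold_mxX; apply: fold_mx1.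
Qed.

Lemma map_fold_mx_n k l (Y : 'M[R]_(k, l)) Y' :
  fold_mx n Y Y' -> map_mx phi Y = Y'.
Proof.
move=> hY; apply/matrixP => i j; rewrite mxE.
by have := hY [::] erefl i j; rewrite !big_nil !mul1r.
Qed.

Lemma map_mx_npotent k (e : 'M[R]_k) :
  (1 < n)%N -> e ^+ n = e -> map_mx phi e ^+ n = map_mx phi e.
Proof.
move=> n_gt1 he; rewrite -[in RHS]he; apply/esym/map_fold_mx_n.
by have := @fold_mx_expr n.-1 _ e; rewrite (ltn_predK n_gt1).
Qed.

Lemma expr_mulmxC k l (a : 'M[R]_(k, l)) (b : 'M[R]_(l, k)) p :
  (a *m b) ^+ p.+1 = a *m (b *m a) ^+ p *m b.
Proof.
elim: p => [|p IH]; first by rewrite expr1 expr0 mulmx1.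
rewrite exprS IH exprS -[LHS]/(_ *m _) -[(b *m a) * _]/(_ *m _).
by rewrite !mulmxA.
Qed.

(** Since [phi(a b)] need not be [phi(a) phi(b)], both [e] and [f] are first
    written as products of the same [n] factors [a], [f] ([n - 2] times) and
    [f b], in orders that differ by a cyclic rotation only. *)
Lemma map_mx_swap k l (e : 'M[R]_k) (f : 'M[R]_l) a b :
  (1 < n)%N -> e ^+ n = e -> f ^+ n = f -> e = a *m b -> f = b *m a ->
  exists (A : 'M[S]_(k, l)) (B : 'M[S]_(l, k)),
    map_mx phi e = A *m B /\ map_mx phi f = B *m A.
Proof.
move=> n_gt1 he hf eab fba.
have n1 : (n.-2 + 1 = n.-1)%N by rewrite addn1; case: (n) n_gt1 => [|[]].
have n2 : (n.-2 + 2 = n)%N by rewrite addnS n1 (ltn_predK n_gt1).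
have eE : e = a *m (f ^+ n.-2 *m (f *m b)).
  transitivity ((a *m b) ^+ n); first by rewrite -eab he.
  rewrite -[in LHS](ltn_predK n_gt1) expr_mulmxC -fba -n1 addn1 exprSr.
  by rewrite -!mulmxA.
have fE : f = f ^+ n.-2 *m ((f *m b) *m a).
  rewrite -(mulmxA f) -fba [RHS]mulmxA -[LHS]hf -[in LHS]n2 addn2.
  by rewrite !exprSr.
exists (map_mx phi a), (map_mx phi f ^+ n.-2 *m map_mx phi (f *m b)); split.
  rewrite [in LHS]eE; apply: map_fold_mx_n.
  rewrite -{1}n2 addnS; apply: fold_mxS; apply: fold_mxX.
  exact: fold_mx1.
rewrite [in LHS]fE -[RHS]mulmxA; apply: map_fold_mx_n.
rewrite -{1}n2; apply: fold_mxX; apply: fold_mxS; exact: fold_mx1.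
Qed.

End NhomMatrix.

(** * Functoriality of the Grothendieck completion *)

Section GrothMap.
Variables (M N : nmodType) (f : {additive M -> N}).

Definition groth_map (x : groth M) : groth N :=
  \pi_(groth N) (f (repr x).1, f (repr x).2).

Lemma groth_mapE x : groth_map (\pi x) = \pi_(groth N) (f x.1, f x.2).
Proof.
apply/groth_piP => /=.
have [k Hk] := (groth_piP _ x).2 (reprK (\pi_(groth M) x)).
by exists (f k); rewrite -!raddfD Hk.
Qed.

Lemma groth_map_is_additive : nmod_morphism groth_map.
Proof.
split=> [|x y]; first by rewrite [LHS]groth_mapE /= !raddf0.
elim/quotW: x => x; elim/quotW: y => y.
by rewrite [X in groth_map X]groth_addE !groth_mapE [RHS]groth_addE /= !raddfD.
Qed.

HB.instance Definition _ :=
  GRing.isNmodMorphism.Build (groth M) (groth N) groth_map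
    groth_map_is_additive.

Lemma groth_map_in a : groth_map (groth_in a) = groth_in (f a).
Proof. by rewrite /groth_in groth_mapE /= raddf0. Qed.

End GrothMap.

(** * The monoid morphism induced on classes of n-potents *)

Lemma npotent_of_irr n (R : pzRingType) k (e f : 'M[R]_k) (he : e ^+ n = e)
    (hf : f ^+ n = f) : e = f -> npotent_of he = npotent_of hf.
Proof. by move=> ef; subst f; rewrite (Prop_irrelevance he hf). Qed.

Lemma npotent_of_mx n (R : pzRingType) (e : npotent n R) :
  npotent_of (npotent_mxP e) = e.
Proof. by apply: val_inj; case: e => -[]. Qed.

Section VnMap.
Variables (n : nat) (n_gt1 : (1 < n)%N) (R S : pzRingType) (phi : nhom n R S).

Definition npotent_map (e : npotent n R) : npotent n S :=
  npotent_of (map_mx_npotent phi n_gt1 (npotent_mxP e)).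

Lemma npotent_map_compat e f :
  npotent_rel e f -> npotent_rel (npotent_map e) (npotent_map f).
Proof.
move=> /(npotent_relP n_gt1)[a [b [eab fba]]]; apply/(npotent_relP n_gt1).
exact: (map_mx_swap phi n_gt1 (npotent_mxP e) (npotent_mxP f) eab fba).
Qed.

Definition Vn_map (x : Vn n_gt1 R) : Vn n_gt1 S :=
  \pi_(Vn n_gt1 S) (npotent_map (repr x)).

Lemma Vn_mapE e : Vn_map (\pi e) = \pi_(Vn n_gt1 S) (npotent_map e).
Proof.
by apply/Vn_piP/npotent_map_compat/(Vn_piP n_gt1); rewrite reprK.
Qed.

Lemma Vn_map_is_additive : nmod_morphism Vn_map.
Proof.
split=> [|x y].
  rewrite [LHS]Vn_mapE; congr \pi; apply: npotent_of_irr.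
  exact: map_mx0.
elim/quotW: x => e; elim/quotW: y => f.
rewrite [X in Vn_map X]Vn_addE !Vn_mapE [RHS]Vn_addE; congr \pi.
by apply: npotent_of_irr; rewrite map_block_mx !map_mx0.
Qed.

HB.instance Definition _ :=
  GRing.isNmodMorphism.Build (Vn n_gt1 R) (Vn n_gt1 S) Vn_map
    Vn_map_is_additive.

End VnMap.

Lemma Vn_map_id n (n_gt1 : (1 < n)%N) (R : pzRingType) (x : Vn n_gt1 R) :
  Vn_map (nhom_id n R) x = x.
Proof.
elim/quotW: x => e; rewrite Vn_mapE; congr \pi.
rewrite -[RHS]npotent_of_mx; apply: npotent_of_irr.
exact: map_mx_id.
Qed.

Lemma Vn_map_comp n (n_gt1 : (1 < n)%N) (R S T : pzRingType) (g : nhom n S T)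
    (f : nhom n R S) (x : Vn n_gt1 R) :
  Vn_map (nhom_comp g f) x = Vn_map g (Vn_map f x).
Proof.
elim/quotW: x => e; rewrite !Vn_mapE; congr \pi.
by apply: npotent_of_irr; apply: map_mx_comp.
Qed.

(** * The functor *)

Definition K0n_map n (n_gt1 : (1 < n)%N) (R S : pzRingType) (phi : nhom n R S) :
    {additive K0n n_gt1 R -> K0n n_gt1 S} :=
  groth_map (Vn_map (n_gt1 := n_gt1) phi).

Theorem proposition4p2 (n : nat) (n_ge2 : (2 <= n)%N) :
  exists induced : forall R S : pzRingType,
      nhom n R S -> {additive K0n n_ge2 R -> K0n n_ge2 S},
    (forall (R S : pzRingType) (phi : nhom n R S) (k : nat) (e : 'M[R]_k)
       (he : e ^+ n = e),
       exists hphie : map_mx phi e ^+ n = map_mx phi e,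
         induced R S phi (K0n_class n_ge2 he) = K0n_class n_ge2 hphie) /\
    @is_covariant_functor (nring_category n) ab_category
      (fun R : pzRingType => K0n n_ge2 R) induced.
Proof.
exists (@K0n_map n n_ge2); split=> [R S phi k e he|].
  exists (map_mx_npotent phi n_ge2 he).
  rewrite [LHS]groth_map_in; apply: congr1; rewrite [LHS]Vn_mapE.
  by congr \pi; apply: npotent_of_irr.
split=> [R|R S T g f]; apply: additive_ext; elim/quotW=> x.
  by rewrite [LHS]groth_mapE /= !Vn_map_id; case: x.
rewrite [LHS]groth_mapE /= !Vn_map_comp.
transitivity (K0n_map n_ge2 g (K0n_map n_ge2 f (\pi x))); last by [].
by rewrite [X in K0n_map n_ge2 g X]groth_mapE [RHS]groth_mapE.
Qed.
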